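(* Let $g,k,l$ be integers with $g\geqslant2$ and $k,l\geqslant1$. Fix distinct points $c_1,c_2,\dots,c_{g+1}$ on the unit circle in $\mathbb{C}$. For $z\neq0$ let $C_{i,z}:=C(c_i,|z|^k)$ for $i=1,2,\dots,g$ and $C_{g+1,z}:=C(c_{g+1},|z|^l)$, where $C(a,r)\subseteq\mathbb{C}$ denotes the circle centered at $a$ of radius $r$. Let $\Gamma_z$ be the group generated by the reflections with respect to the circles $C_{i,z}$, $i=1,2,\dots,g+1$. Then the Hausdorff dimension $s(z)$ of the limit set of $\Gamma_z$ satisfies $$s(z)\sim\frac{-\log u}{2\log|z^{-1}|}$$ as $z\to0$, where $u$ is the largest (real) root of $X^{k+l}+(1-1/g)X^k-1/g$.
   Context: The reflection with respect to a circle $C(a,r)$ is the inversion $w\mapsto a+r^2/\overline{(w-a)}$ of $\mathbb{P}^1(\mathbb{C})$. The group $\Gamma_z$ is called a Schottky reflection group; for $|z|$ small the closed disks bounded by the circles $C_{i,z}$ are pairwise disjoint. Its limit set is the set of accumulation points of orbits of $\Gamma_z$ on $\mathbb{P}^1(\mathbb{C})$ (equivalently, the limit set of its index-two subgroup of Möbius transformations, which is a Schottky group). Hausdorff dimension is for the spherical metric on $\mathbb{P}^1(\mathbb{C})$. The notation $f(z)\sim h(z)$ means $f(z)/h(z)\to1$. *)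

(* Defs.v *)
From HB Require Import structures.
From mathcomp Require Import all_boot all_order all_algebra.
From mathcomp Require Import all_classical all_reals all_analysis.
From mathcomp.real_closed Require Import complex.

Set Implicit Arguments.
Unset Strict Implicit.
Unset Printing Implicit Defensive.

Import Order.TTheory GRing.Theory Num.Theory.
Import numFieldNormedType.Exports.

Local Open Scope classical_set_scope.
Local Open Scope ring_scope.

Section Hausdorff.
Context {R : realType} {T : Type} (d : T -> T -> R).
Local Open Scope ereal_scope.

(* For U empty this is -oo; empty pieces are left out of the sums below. *)
Definition diameter (U : set T) : \bar R :=
  ereal_sup [set (d x.1 x.2)%:E | x in U `*` U].

Definition hausdorff_content (delta s : R) (A : set T) : \bar R :=
  ereal_inf [set \sum_(0 <= i <oo | U i != set0) diameter (U i) `^ s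
            | U in [set U : nat -> set T |
                     A `<=` \bigcup_i U i /\
                     forall i, diameter (U i) <= delta%:E]].

Definition hausdorff_measure (s : R) (A : set T) : \bar R :=
  ereal_sup [set hausdorff_content delta s A
            | delta in [set delta : R | (0 < delta)%R]].

Definition hausdorff_dim (A : set T) : \bar R :=
  ereal_inf [set s%:E | s in [set s : R | (0 <= s)%R /\
                                          hausdorff_measure s A = 0]].

End Hausdorff.

Section TransformationGroups.
Context {T : Type}.

Definition transformation_group (G : set (T -> T)) : Prop :=
  [/\ G idfun,
      forall f h, G f -> G h -> G (f \o h) &
      forall f h, G f -> cancel f h -> cancel h f -> G h].

Definition generated_group (S : set (T -> T)) : set (T -> T) :=
  smallest transformation_group S.

Definition orbit_of (G : set (T -> T)) (x : T) : set T := [set f x | f in G].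

End TransformationGroups.

Definition limit_set {T : topologicalType} (G : set (T -> T)) : set T :=
  \bigcup_x limit_point (orbit_of G x).

Section RiemannSphere.
Context {R : realType}.

(* [Some w] is the finite point w and [None] the point at infinity; the alias
   [R[i]^o] is the one carrying the usual topology of the complex plane. *)
Definition P1 : topologicalType := one_point_compactification R[i]^o.

(* The norm of R[i] takes its values in R[i]; this is the same number in R. *)
Definition modulus (w : R[i]) : R := complex.Re `|w|.

(* Great-circle distance for the identification of P1 with the unit sphere by
   stereographic projection: an angle t subtends a chord of length 2 sin (t/2),
   and the points z, w of the plane are at chordal distance
   2 |z - w| / (sqrt (1 + |z|^2) * sqrt (1 + |w|^2)). *)
Definition half_chord (x y : P1) : R :=
  match x, y with
  | Some z, Some w =>
      modulus (z - w) / (Num.sqrt (1 + modulus z ^+ 2) *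
                         Num.sqrt (1 + modulus w ^+ 2))
  | Some z, None | None, Some z => (Num.sqrt (1 + modulus z ^+ 2))^-1
  | None, None => 0
  end.

(* asin takes its values in [0, pi/2] here, so antipodal points are at
   distance pi. *)
Definition spherical_dist (x y : P1) : R := 2 * asin (half_chord x y).

(* Reflection with respect to the circle of center a and radius r. *)
Definition reflection (a : R[i]) (r : R) (x : P1) : P1 :=
  match x with
  | Some w => if w == a then None
              else Some (a + (r ^+ 2)%:C%C / conjc (w - a))
  | None => Some a
  end.

(* The circles are indexed by 'I_g.+1, the last one having index ord_max. *)
Definition schottky_radius (g k l : nat) (z : R[i]) (i : 'I_g.+1) : R :=
  modulus z ^+ (if i == ord_max then l else k).

Definition schottky_reflection_group (g k l : nat) (c : 'I_g.+1 -> R[i])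
    (z : R[i]) : set (P1 -> P1) :=
  generated_group (range (fun i => reflection (c i) (schottky_radius k l z i))).

Definition schottky_poly (g k l : nat) : {poly R} :=
  'X^(k + l) + (1 - g%:R^-1) *: 'X^k - (g%:R^-1)%:P.

Definition largest_root (p : {poly R}) (u : R) : Prop :=
  root p u /\ forall v : R, root p v -> v <= u.

End RiemannSphere.

Arguments P1 : clear implicits.

(* Main.v *)
(* The disks are mapped into one another almost like a graph-directed system of
   similarities: the reflection in the i-th circle maps the j-th disk (j != i)
   into the i-th one and multiplies distances by r_i^2 up to a factor A = 9/d^2
   depending only on the centers. For exact similarities of ratio r_i^2 = |z|^(2 k_i)
   the dimension s would make the matrix with entries r_i^(2s) [i != j] have
   spectral radius 1, and t = |z|^(2s) is then the root u of the polynomial. Since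
   s -> 0, the error A^s tends to 1.

   Upper bound: cover the limit set by the images of the disks under the reduced
   words of length n. Lower bound: the matrix yields an additive mass on words,
   and a set meeting the limit points of two different extensions of a word v has
   diameter^s at least a constant times the mass of v; given a covering of
   too small total size, one follows the underloaded branches of the tree of words
   to reach a limit point which is not covered. *)

Require Import Defs.
From HB Require Import structures.
From mathcomp Require Import all_boot all_order all_algebra.
From mathcomp Require Import all_classical all_reals all_analysis.
From mathcomp.real_closed Require Import complex.
From mathcomp Require Import ring lra.

Set Implicit Arguments.
Unset Strict Implicit.
Unset Printing Implicit Defensive.

Import Order.TTheory GRing.Theory Num.Theory.
Import numFieldNormedType.Exports.

Local Open Scope classical_set_scope.
Local Open Scope ring_scope.

(** * The real-valued modulus on [R[i]] and its topology *)

Section Modulus.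
Context {R : realType}.
Implicit Types (z w : R[i]).

Lemma normC_modulus w : `|w| = (modulus w)%:C%C.
Proof. by rewrite /modulus normc_def. Qed.

Lemma modulus_ge0 w : 0 <= modulus w.
Proof. by have := normr_ge0 w; rewrite normC_modulus lecR. Qed.

Lemma modulus0 : modulus (0 : R[i]) = 0.
Proof. by rewrite /modulus normr0. Qed.

Lemma modulus_eq0 w : (modulus w == 0) = (w == 0).
Proof. by rewrite -[RHS]normr_eq0 normC_modulus -(inj_eq (@complexI R)). Qed.

Lemma modulus_gt0 w : (0 < modulus w) = (w != 0).
Proof. by rewrite lt_neqAle modulus_ge0 andbT eq_sym modulus_eq0. Qed.

Lemma modulusM z w : modulus (z * w) = modulus z * modulus w.
Proof. exact: ComplexField.Normc.normcM. Qed.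

Lemma modulusV w : modulus w^-1 = (modulus w)^-1.
Proof. exact: ComplexField.Normc.normcV. Qed.

Lemma modulusD z w : modulus (z + w) <= modulus z + modulus w.
Proof. by rewrite -lecR rmorphD /= -!normC_modulus ler_normD. Qed.

Lemma modulusN w : modulus (- w) = modulus w.
Proof. by rewrite /modulus normrN. Qed.

Lemma modulusC z w : modulus (z - w) = modulus (w - z).
Proof. by rewrite -modulusN opprB. Qed.

Lemma modulus_conj w : modulus (conjc w) = modulus w.
Proof. by rewrite /modulus normcJ. Qed.

Lemma modulus_real (x : R) : 0 <= x -> modulus x%:C%C = x.
Proof. by move=> x0; rewrite /modulus ger0_norm ?lecR. Qed.

Lemma modulus_dist z w x : modulus (z - w) <= modulus (z - x) + modulus (x - w).
Proof. by rewrite (_ : z - w = (z - x) + (x - w)) ?modulusD //; ring. Qed.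

Lemma Re_le_modulus w : `|complex.Re w| <= modulus w.
Proof. by rewrite -lecR -normC_modulus normc_ge_Re. Qed.

Lemma Im_le_modulus w : `|complex.Im w| <= modulus w.
Proof.
have := Re_le_modulus (w * 'i%C); rewrite modulusM ReiNIm normrN.
by rewrite [modulus 'i%C]/modulus normc_def /= expr0n expr1n add0r sqrtr1 mulr1.
Qed.

Lemma modulus_le_ReIm w : modulus w <= `|complex.Re w| + `|complex.Im w|.
Proof.
have s0 : 0 <= `|complex.Re w| + `|complex.Im w| by rewrite addr_ge0.
rewrite /modulus normc_def /= -(ger0_norm s0) -sqrtr_sqr ler_sqrt ?sqr_ge0 //.
by rewrite sqrrD !real_normK ?num_real // lerD2r lerDl mulrn_wge0 ?mulr_ge0.
Qed.

Lemma nbhs_modulusP (w : R[i]^o) (U : set R[i]^o) :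
  nbhs w U <-> exists2 e : R, 0 < e & forall z, modulus (w - z) < e -> U z.
Proof.
split.
  move=> /nbhs_ballP[e /= e0 eU].
  have eR : e = (complex.Re e)%:C%C by rewrite RRe_real // gtr0_real.
  move: e0 eU; rewrite eR ltcR => e0 eU; exists (complex.Re e) => // z wz.
  by apply: eU; rewrite /ball /= normC_modulus ltcR.
move=> [e e0 eU]; apply/nbhs_ballP; exists e%:C%C; first by rewrite /= ltcR.
by move=> z; rewrite /ball /= normC_modulus ltcR; exact: eU.
Qed.

End Modulus.

(** * Comparison of the spherical distance with the Euclidean one *)

Section SphericalDistance.
Context {R : realType}.
Implicit Types (z w : R[i]).

(** Mean value theorem for [sin] on [[0, asin x]]: the derivative there lies between
    [cos (asin x) = sqrt (1 - x^2)] and 1. *)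
Lemma asin_MVT (x : R) : 0 <= x <= 1 ->
  exists2 c, Num.sqrt (1 - x ^+ 2) <= c <= 1 & 0 <= asin x /\ x = c * asin x.
Proof.
move=> /andP[x0 x1]; have x11 : -1 <= x <= 1 by rewrite x1 andbT; lra.
have [yb sy] := asin_def x11; have p0 := pi_gt0 R.
have pb : 0 \in `[- (pi / 2), pi / 2 : R] by rewrite in_itv /=; lra.
have y0 : 0 <= asin x.
  by rewrite leNgt -ltr_sin ?in_itv //= sin0 sy -leNgt.
have [c] := @MVT_segment R sin cos 0 (asin x) y0 (fun x _ => is_derive_sin x)
  (continuous_subspaceT (@continuous_sin R)).
rewrite sin0 !subr0 sy in_itv /= => /andP[c0 cy] xE.
exists (cos c); rewrite // cos_le1 andbT -cos_asin //.
by rewrite leNgt ltr_cos ?in_itv /= -?leNgt //; lra.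
Qed.

Lemma le_asin_id (x : R) : 0 <= x <= 1 -> x <= asin x.
Proof.
by move=> /asin_MVT[c /andP[_ c1] [y0 xE]]; rewrite {1}xE ler_piMl.
Qed.

Lemma asin_le_double (x : R) : 0 <= x <= 1 / 2 -> asin x <= 2 * x.
Proof.
move=> /andP[x0 x1]; have [|c /andP[xc _] [y0 xE]] := @asin_MVT x; first by lra.
have: 1 / 2 <= c.
  apply: le_trans xc; rewrite -[leLHS]ger0_norm ?divr_ge0 // -sqrtr_sqr.
  have x2 : x ^+ 2 <= 1 / 4 by nra.
  by rewrite ler_sqrt; lra.
by move: (asin x) y0 xE => y y0 xE c2; nra.
Qed.

Lemma half_chord_Some z w : half_chord (Some z) (Some w) =
  modulus (z - w) / (Num.sqrt (1 + modulus z ^+ 2) * Num.sqrt (1 + modulus w ^+ 2)).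
Proof. by []. Qed.

Lemma sqrt_1Dsqr (x : R) : 0 < Num.sqrt (1 + x ^+ 2).
Proof. by rewrite sqrtr_gt0 ltr_wpDr ?sqr_ge0. Qed.

Lemma half_chord_ge0_le1 (x y : P1 R) : 0 <= half_chord x y <= 1.
Proof.
have sq1 (a : R) : 1 <= Num.sqrt (1 + a ^+ 2).
  by rewrite -[leLHS]sqrtr1 ler_sqrt ?addr_ge0 ?sqr_ge0 // lerDl sqr_ge0.
case: x y => [z|] [w|] /=; rewrite ?invr_ge0 ?sqrtr_ge0 ?invf_le1 ?sqrt_1Dsqr
  ?sq1 ?lexx ?ler01 //.
rewrite divr_ge0 ?modulus_ge0 ?mulr_ge0 ?sqrtr_ge0 //=.
rewrite ler_pdivrMr ?mulr_gt0 ?sqrt_1Dsqr // mul1r.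
have := modulusD z (- w); rewrite modulusN => /le_trans; apply.
have := modulus_ge0 z; have := modulus_ge0 w.
move: (modulus z) (modulus w) => a b b0 a0.
rewrite -sqrtrM ?addr_ge0 ?sqr_ge0 // -(ger0_norm (addr_ge0 a0 b0)) -sqrtr_sqr.
rewrite ler_sqrt ?mulr_ge0 ?addr_ge0 ?sqr_ge0 //.
(* Cauchy-Schwarz: [(1 + a^2) * (1 + b^2) - (a + b)^2 = (1 - a * b)^2]. *)
have := sqr_ge0 (1 - a * b); nra.
Qed.

Lemma spherical_distxx (x : P1 R) : spherical_dist x x = 0.
Proof.
rewrite /spherical_dist.
have -> : half_chord x x = 0.
  by case: x => //= z; rewrite subrr modulus0 mul0r.
have := @le_asin_id 0; have := @asin_le_double 0; rewrite lexx mulr0 ler01.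
rewrite divr_ge0 // => /(_ isT) h1 /(_ isT) h2.
by rewrite (@le_anti _ _ (asin 0) 0) ?mulr0 ?h1.
Qed.

Lemma spherical_dist_le z w : modulus (z - w) <= 1 / 2 ->
  spherical_dist (Some z) (Some w) <= 4 * modulus (z - w).
Proof.
move=> zw; have h := half_chord_ge0_le1 (Some z) (Some w).
have hzw : half_chord (Some z) (Some w) <= modulus (z - w).
  rewrite half_chord_Some ler_piMr ?modulus_ge0 // invf_le1 ?mulr_gt0 ?sqrt_1Dsqr //.
  by rewrite -[leLHS]mulr1 ler_pM // -[leLHS]sqrtr1 ler_sqrt ?addr_ge0 ?sqr_ge0 //
     lerDl sqr_ge0.
have : asin (half_chord (Some z) (Some w)) <= 2 * half_chord (Some z) (Some w).
  by apply: asin_le_double; case/andP: h => -> _ /=; exact: le_trans zw.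
by rewrite /spherical_dist; nra.
Qed.

(** For points of modulus at most 2 each square root in the half chord is at most [sqrt 5], whence
    the 5. *)
Lemma spherical_dist_ge z w : modulus z <= 2 -> modulus w <= 2 ->
  modulus (z - w) / 5 <= spherical_dist (Some z) (Some w).
Proof.
move=> z2 w2; have h := half_chord_ge0_le1 (Some z) (Some w).
have := le_asin_id h; rewrite /spherical_dist half_chord_Some => hzw.
apply: (@le_trans _ _ (half_chord (Some z) (Some w))); last first.
  by rewrite half_chord_Some; case/andP: h; rewrite half_chord_Some; nra.
rewrite half_chord_Some ler_wpM2l ?modulus_ge0 // lef_pV2 ?posrE ?mulr_gt0 //.
  rewrite -sqrtrM ?addr_ge0 ?sqr_ge0 // -[leRHS]ger0_norm // -sqrtr_sqr.
  have := modulus_ge0 z; have := modulus_ge0 w => w0 z0.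
  rewrite ler_sqrt ?sqr_ge0 // [leRHS]expr2 ler_pM ?addr_ge0 ?sqr_ge0 //; nra.
all: exact: sqrt_1Dsqr.
Qed.
End SphericalDistance.

(** * Reduced words: no letter is repeated at once, a reflection being its own inverse *)

Definition reduced {I : eqType} (v : seq I) := sorted (fun i j => i != j) v.

Lemma reduced_cons {I : eqType} (i j : I) (v : seq I) :
  reduced (rcons (i :: v) j) = (i != head j v) && reduced (rcons v j).
Proof. by case: v. Qed.

Lemma reduced_rcons {I : eqType} (v : seq I) (i j : I) :
  reduced (rcons (rcons v i) j) = reduced (rcons v i) && (i != j).
Proof. by case: v => [|k v] /=; rewrite ?andbT // rcons_path last_rcons. Qed.

Lemma reduced_rconsW {I : eqType} (v : seq I) (j : I) :
  reduced (rcons v j) -> reduced v.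
Proof.
by elim/last_ind: v => // v i _; rewrite reduced_rcons => /andP[].
Qed.

(** * Inversions and their words as near-similarities on the disks *)

Section Inversions.
Context {R : realType} {I : finType} (c : I -> R[i]) (r : I -> R) (d : R).

(** The reflection read in the plane. At the center, division by zero yields the meaningless value
    [c i]; the estimates stay away from that point. *)
Definition inversion i (w : R[i]) : R[i] :=
  c i + (r i ^+ 2)%:C%C / conjc (w - c i).

Definition disc i : set R[i] := [set w | modulus (w - c i) <= r i].

(** Upper and lower Lipschitz constants of the i-th inversion on the other disks: [r i ^+ 2] up to
    one common factor [9 / d ^+ 2], in both directions. *)
Definition lipc i := r i ^+ 2 * (9 / d ^+ 2).
Definition colipc i := r i ^+ 2 / (9 / d ^+ 2).

Lemma reflection_Some i w : w != c i ->
  reflection (c i) (r i) (Some w) = Some (inversion i w).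
Proof. by rewrite /reflection => /negPf ->. Qed.

Lemma inversion_dist i w w' : w != c i -> w' != c i ->
  modulus (inversion i w - inversion i w') =
  r i ^+ 2 * modulus (w - w') / (modulus (w - c i) * modulus (w' - c i)).
Proof.
move=> wc w'c; have wc0 : conjc (w - c i) != 0 by rewrite conjc_eq0 subr_eq0.
have w'c0 : conjc (w' - c i) != 0 by rewrite conjc_eq0 subr_eq0.
have -> : inversion i w - inversion i w' =
    (r i ^+ 2)%:C%C * conjc (w' - w) / (conjc (w - c i) * conjc (w' - c i)).
  rewrite /inversion (_ : w' - w = (w' - c i) - (w - c i)); last by ring.
  rewrite [conjc (_ - _ - _)]rmorphB /=.
  move: (conjc (w - c i)) (conjc (w' - c i)) wc0 w'c0 => a b a0 b0.
  by field; rewrite a0 b0.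
by rewrite !(modulusM, modulusV, modulus_conj) modulus_real ?sqr_ge0 // (modulusC w').
Qed.

Hypotheses (d01 : 0 < d <= 1) (c1 : forall i, modulus (c i) = 1)
  (c_sep : forall i j, i != j -> d <= modulus (c i - c j))
  (r_bnd : forall i, 0 < r i <= d / 4).

Let r_gt0 i : 0 < r i. Proof. by case/andP: (r_bnd i). Qed.

Lemma lipc_gt0 i : 0 < lipc i.
Proof. by case/andP: d01 => d0 _; rewrite mulr_gt0 ?divr_gt0 ?exprn_gt0. Qed.

Lemma colipc_gt0 i : 0 < colipc i.
Proof. by case/andP: d01 => d0 _; rewrite !divr_gt0 ?exprn_gt0. Qed.

(** The radii are at most [d / 4], and [(d / 4)^2 * 9 / d^2 = 9 / 16]: a contraction ratio uniform
    in all the data. *)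
Lemma lipc_le i : lipc i <= 9 / 16.
Proof.
case/andP: d01 => d0 _; case/andP: (r_bnd i) => r0 rd.
rewrite /lipc mulrA ler_pdivrMr ?exprn_gt0 //; nra.
Qed.

Lemma colipc_le i : colipc i <= lipc i.
Proof.
case/andP: d01 => d0 d1; rewrite ler_wpM2l ?sqr_ge0 // invf_div.
have d2 : 0 < d ^+ 2 by rewrite exprn_gt0.
have d21 : d ^+ 2 <= 1 by nra.
by rewrite ler_pdivrMr // mulrAC ler_pdivlMr //; nra.
Qed.

Lemma disc_modulus_le i w : disc i w -> modulus w <= 5 / 4.
Proof.
case/andP: d01 => d0 d1; case/andP: (r_bnd i) => r0 rd.
have := modulusD (w - c i) (c i); rewrite subrK c1 /disc /=; lra.
Qed.

Lemma disc_dist_le i j w w' : disc i w -> disc j w' -> modulus (w - w') <= 4.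
Proof.
move=> /disc_modulus_le wi /disc_modulus_le w'j.
by have := modulusD w (- w'); rewrite modulusN; lra.
Qed.

(** The centers are [d] apart and each radius takes away at most [d / 4]. *)
Lemma disc_dist_ge i j w w' : i != j -> disc i w -> disc j w' ->
  d / 2 <= modulus (w - w').
Proof.
case/andP: (r_bnd i) => ri0 rid; case/andP: (r_bnd j) => rj0 rjd.
rewrite /disc /= => /c_sep; have := modulus_dist (c i) (c j) w.
have := modulus_dist w (c j) w'; rewrite (modulusC (c i) w); lra.
Qed.

Lemma disc_center i : disc i (c i).
Proof. by rewrite /disc /= subrr modulus0 ltW. Qed.

Lemma inversion_disc i w : r i <= modulus (w - c i) -> disc i (inversion i w).
Proof.
move=> rw; have w0 := lt_le_trans (r_gt0 i) rw.
rewrite /disc /= /inversion addrC addKr modulusM modulusV modulus_conj.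
rewrite modulus_real ?sqr_ge0 // ler_pdivrMr // expr2 ler_wpM2l //.
exact: ltW.
Qed.

Lemma inversion_disc_neq i j w : i != j -> disc j w -> disc i (inversion i w).
Proof.
move=> ij jw; apply: inversion_disc; have := disc_dist_ge ij (disc_center i) jw.
case/andP: d01 => d0 d1; case/andP: (r_bnd i) => ri0 rid.
by rewrite (modulusC w); lra.
Qed.

Lemma disc_neq_center i j w : i != j -> disc j w -> w != c i.
Proof.
move=> ij jw; case/andP: d01 => d0 d1.
have := disc_dist_ge ij (disc_center i) jw; apply: contraTneq => ->.
by rewrite subrr modulus0 -ltNge; lra.
Qed.

(** Points of the other disks are at distance between [d / 2] and 3 from [c i], so the denominator
    in [inversion_dist] lies between [d^2 / 4] and 9. The disks [j] and [j'] may coincide or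
    differ. *)
Lemma inversion_bilip i j j' w w' : i != j -> i != j' -> disc j w -> disc j' w' ->
  colipc i * modulus (w - w') <= modulus (inversion i w - inversion i w')
  <= lipc i * modulus (w - w').
Proof.
move=> ij ij' jw j'w'; have wc := disc_neq_center ij jw.
have w'c := disc_neq_center ij' j'w'; case/andP: d01 => d0 d1.
rewrite inversion_dist // [r i ^+ 2 * _ / _]mulrAC.
have far k z : i != k -> disc k z -> d / 2 <= modulus (z - c i) <= 3.
  move=> ik kz; have := disc_dist_ge ik (disc_center i) kz.
  rewrite (modulusC z) => -> /=.
  have := disc_modulus_le (disc_center i); have := disc_modulus_le kz.
  by have := modulusD (c i) (- z); rewrite modulusN; lra.
have /andP[a1 a2] := far _ _ ij jw; have /andP[b1 b2] := far _ _ ij' j'w'.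
have a0 : 0 < modulus (w - c i) by lra.
have b0 : 0 < modulus (w' - c i) by lra.
have ab0 : 0 < modulus (w - c i) * modulus (w' - c i) by rewrite mulr_gt0.
have ab9 : modulus (w - c i) * modulus (w' - c i) <= 9 by nra.
have abd : d ^+ 2 / 4 <= modulus (w - c i) * modulus (w' - c i) by nra.
have d2 : 0 < d ^+ 2 by rewrite exprn_gt0.
have d21 : d ^+ 2 <= 1 by nra.
apply/andP; split; rewrite ler_wpM2r ?modulus_ge0 // ler_wpM2l ?sqr_ge0 //.
  by rewrite lef_pV2 ?posrE ?divr_gt0 // ler_pdivlMr //; nra.
by rewrite -[leRHS]invf_div lef_pV2 ?posrE ?divr_gt0 // ler_pdivrMr //; nra.
Qed.

Lemma word_disc v j y : reduced (rcons v j) -> disc j y ->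
  disc (head j v) (foldr inversion y v).
Proof.
elim: v => // i v IH; rewrite reduced_cons => /andP[iv vj] jy.
exact: inversion_disc_neq iv (IH vj jy).
Qed.

(** Iterates [inversion_bilip], since by [word_disc] every letter acts on points of other disks.
    Allowing two different last disks is what later separates the branches at [v]. *)
Lemma word_bilip v j j' y y' : reduced (rcons v j) -> reduced (rcons v j') ->
    disc j y -> disc j' y' ->
  (\prod_(i <- v) colipc i) * modulus (y - y')
  <= modulus (foldr inversion y v - foldr inversion y' v)
  <= (\prod_(i <- v) lipc i) * modulus (y - y').
Proof.
move=> + + jy j'y'; elim: v => [|i v IH]; first by rewrite !big_nil !mul1r lexx.
rewrite !reduced_cons => /andP[iv vj] /andP[iv' vj']; rewrite !big_cons /=.
have /andP[h1 h2] := IH vj vj'.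
have /andP[] := inversion_bilip iv iv' (word_disc vj jy) (word_disc vj' j'y').
move=> h3 h4; apply/andP; split.
  by apply: le_trans h3; rewrite -mulrA ler_wpM2l ?(ltW (colipc_gt0 i)).
by apply: le_trans h4 _; rewrite -mulrA ler_wpM2l ?(ltW (lipc_gt0 i)).
Qed.

Lemma prod_lipc_le v : \prod_(i <- v) lipc i <= (9 / 16) ^+ size v.
Proof.
elim: v => [|i v IH]; first by rewrite big_nil expr0.
rewrite big_cons /= exprS ler_pM ?lipc_le ?(ltW (lipc_gt0 i)) //.
by rewrite prodr_ge0 // => k _; exact: ltW (lipc_gt0 k).
Qed.

End Inversions.

(** * Orbits of a group generated by involutions *)

Section GeneratedGroup.
Context {T : Type} (S : set (T -> T)).

Lemma generated_group_comp f h : S f -> generated_group S h ->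
  generated_group S (f \o h).
Proof.
move=> Sf Gh M MS; have Mh := Gh M MS; case: MS => -[_ Mcomp _] SM.
by apply: Mcomp => //; exact: SM.
Qed.

Lemma generated_group_id : generated_group S idfun.
Proof. by move=> M [[M1 _ _] _]; exact: M1. Qed.

Hypothesis S_inv : forall f, S f -> involutive f.

Lemma orbit_sub_invariant (O : set T) x :
  (forall f y, S f -> O y -> O (f y)) -> O x ->
  orbit_of (generated_group S) x `<=` O.
Proof.
move=> SO Ox y [f Gf <-].
(* Bijections preserving [O] together with their inverses; including the inverse makes [M] closed
   under inversion, and a generator is its own inverse. *)
pose M := [set f : T -> T | exists h, [/\ cancel f h, cancel h f,
  (forall y, O y -> O (f y)) & (forall y, O y -> O (h y))]].
suff /Gf[h [_ _ fO _]] : transformation_group M /\ S `<=` M by exact: fO.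
split; last by move=> h Sh; exists h; split => // [||z|z]; by [exact: S_inv|exact: SO].
split.
- by exists idfun.
- move=> f1 f2 [h1 [c1 d1 e1 g1]] [h2 [c2 d2 e2 g2]]; exists (h2 \o h1).
  split=> [||z Oz|z Oz]; [exact: can_comp|exact: can_comp| |] => /=.
    by apply: e1; apply: e2.
  by apply: g2; apply: g1.
- move=> f1 f2 [h [fh hf fO hO]] f12 f21; exists f1; split => // z Oz.
  by rewrite (_ : f2 z = h z) //; [exact: hO|rewrite -[z in RHS]f21 fh].
Qed.

End GeneratedGroup.

Lemma filter_forall_mem {T : Type} {A : eqType} (F : set_system T) (L : seq A)
    (P : A -> T -> Prop) : Filter F ->
  (forall a, a \in L -> \forall x \near F, P a x) ->
  \forall x \near F, forall a, a \in L -> P a x.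
Proof.
move=> FF; elim: L => [|a L IH] LP; first by near=> x.
have {}IH := IH (fun b bL => LP b (mem_behead (s := a :: L) bL)).
have Pa := LP a (mem_head _ _).
near=> x => b; rewrite inE => /orP[/eqP->|bL]; first by near: x.
by move: b bL; near: x.
Unshelve. all: by end_near. Qed.

(** * Enumeration of the reduced words of given length *)

Section Words.
Context {I : finType}.

(** Words grow on the right, so that level [n.+1] subdivides the pieces of level [n]. *)
Fixpoint words n : seq (seq I) :=
  if n is m.+1 then
    [seq rcons v j | v <- words m, j <- [seq j <- enum I | reduced (rcons v j)]]
  else [:: [::]].

Lemma mem_words n v : (v \in words n) = reduced v && (size v == n).
Proof.
elim: n v => [|n IH] v /=; first by rewrite mem_seq1 size_eq0;
  case: v => // i v; rewrite andbF.
apply/allpairsPdep/andP => [[w [j [+ + ->]]]|].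
  by rewrite IH mem_filter size_rcons eqSS => /andP[_ ->] /andP[->].
elim/last_ind: v => [[]//|v j _ [vj]]; rewrite size_rcons eqSS => vn.
by exists v, j; rewrite IH (reduced_rconsW vj) vn mem_filter vj mem_enum.
Qed.

End Words.

(** * Covering the limit set by images of the disks *)

Section LimitSet.
Context {R : realType} {I : finType} (c : I -> R[i]) (r : I -> R) (d : R).
Hypotheses (d01 : 0 < d <= 1)
  (c_sep : forall i j, i != j -> d <= modulus (c i - c j))
  (r_bnd : forall i, 0 < r i <= d / 4).

Let r_gt0 i : 0 < r i. Proof. by case/andP: (r_bnd i). Qed.

Local Notation refl i := (reflection (c i) (r i)).
Local Notation inv := (inversion c r).
Local Notation disc := (disc c r).
Local Notation orbit := (orbit_of (generated_group (range (fun i => refl i)))).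

Definition open_disc i : set (P1 R) := Some @` [set w | modulus (w - c i) < r i].

Definition word_refl (v : seq I) (x : P1 R) := foldr (fun i => refl i) x v.

(** The image under [v] of all the disks that may follow it; for the empty word, the union of all
    disks. *)
Definition piece (v : seq I) : set R[i] :=
  [set w | exists j y, [/\ reduced (rcons v j), disc j y & w = foldr inv y v]].

Lemma reflectionK i : involutive (refl i).
Proof.
have ri0 : (r i ^+ 2)%:C%C != 0.
  by rewrite (inj_eq (@complexI R) _ 0) expf_neq0 ?gt_eqF.
case=> [w|] /=; last by rewrite eqxx.
case: eqVneq => [->//|wc] /=.
have w0 : conjc (w - c i) != 0 by rewrite conjc_eq0 subr_eq0.
set q := _ / _; have -> : c i + q - c i = q by rewrite addrC addKr.
rewrite -[_ == c i]subr_eq0 addrC addKr mulf_eq0 invr_eq0 (negPf ri0) (negPf w0) /=.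
have -> : conjc q = (r i ^+ 2)%:C%C / (w - c i).
  apply: etrans (fmorph_div _ _ _) _.
  by congr (_ / _); [exact: conjc_real|exact: conjcK].
by rewrite invfM invrK mulrA divff // mul1r addrC subrK.
Qed.

Lemma orbit_sub (O : set (P1 R)) x :
  (forall i y, O y -> O (refl i y)) -> O x -> orbit x `<=` O.
Proof.
move=> stO; apply: orbit_sub_invariant => [_ [i _ <-]|_ y [i _ <-]].
  exact: reflectionK.
exact: stO.
Qed.

Lemma word_refl_orbit v x : orbit x (word_refl v x).
Proof.
suff [f Gf fE] : exists2 f, generated_group (range (fun i => refl i)) f &
   forall x, f x = word_refl v x by exists f.
elim: v => [|i v [f Gf fE]]; first by exists idfun; first exact: generated_group_id.
exists (refl i \o f) => [|{}x]; first by apply: generated_group_comp => //; exists i.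
by rewrite /= fE.
Qed.

Lemma reflection_outside i x : ~ open_disc i x ->
  exists2 y, disc i y & refl i x = Some y.
Proof.
case: x => [w|_] /=; last by exists (c i) => //; exact: disc_center.
move=> ow; have rw : r i <= modulus (w - c i).
  by rewrite leNgt; apply/negP => wr; apply: ow; exists w.
exists (inv i w); first exact: (inversion_disc r_bnd rw).
case: eqVneq => // wc.
by move: rw; rewrite wc subrr modulus0 leNgt r_gt0.
Qed.

Lemma reflection_inside i x w : open_disc i x -> refl i x = Some w -> ~ disc i w.
Proof.
case=> z zr <-; case: (eqVneq z (c i)) => [->|zc]; first by rewrite /= eqxx.
rewrite reflection_Some // => -[<-]; apply/negP; rewrite -ltNge.
rewrite /inversion addrC addKr modulusM modulusV modulus_conj.
have z0 : 0 < modulus (z - c i) by rewrite modulus_gt0 subr_eq0.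
by rewrite modulus_real ?sqr_ge0 // ltr_pdivlMr // expr2 ltr_pM2l.
Qed.

Lemma reflection_disc_neq i j y : i != j -> disc j y ->
  refl i (Some y) = Some (inv i y).
Proof.
move=> ij jy; rewrite reflection_Some //.
exact: (disc_neq_center d01 c_sep r_bnd ij jy).
Qed.

Lemma word_refl_Some v j y : reduced (rcons v j) -> disc j y ->
  word_refl v (Some y) = Some (foldr inv y v).
Proof.
elim: v => // i v IH; rewrite reduced_cons => /andP[iv vj] jy.
rewrite /word_refl /= [foldr _ (Some y) v]IH //.
exact: reflection_disc_neq iv (word_disc d01 c_sep r_bnd vj jy).
Qed.

(** Ping-pong: the last letter sends the outside point into its own disk, and each earlier letter,
    differing from its successor, moves it on into the next disk. *)
Lemma word_refl_outside i v x : (forall i, ~ open_disc i x) -> reduced (i :: v) ->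
  exists2 y, disc i y & word_refl (i :: v) x = Some y.
Proof.
move=> xo; elim: v i => [|j v IH] i; first by move=> _; exact: reflection_outside.
move=> /= /andP[ij /IH[y jy vy]]; exists (inv i y).
  exact: (inversion_disc_neq d01 c_sep r_bnd ij jy).
by rewrite /word_refl /= in vy *; rewrite vy; exact: reflection_disc_neq jy.
Qed.

(* Points of the sphere reached from the outside of all the disks; the other
   orbits stay in the open disks, hence in the pieces of every level. *)
Definition outer_orbits : set (P1 R) :=
  [set y | exists x v, [/\ (forall i, ~ open_disc i x), reduced v & y = word_refl v x]].

(** A new first letter either keeps the word reduced or cancels the old first letter. *)
Lemma word_refl_stable i x y : (exists2 v, reduced v & y = word_refl v x) ->
  exists2 v, reduced v & refl i y = word_refl v x.
Proof.
case=> -[_ ->|j v vj ->]; first by exists [:: i].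
have [->|ij] := eqVneq i j.
  by exists v; [exact: path_sorted vj|rewrite /word_refl /= reflectionK].
by exists [:: i, j & v]; rewrite //= ij.
Qed.

(** A point off the outer orbits lies in some open disk [i], and its reflection is again off them.
    By induction the reflection lies in a piece of level [n]; being outside disk [i], it belongs to
    a word to which [i] can be prepended. *)
Lemma inner_piece n y : ~ outer_orbits y ->
  exists2 v, v \in words n & (Some @` piece v) y.
Proof.
have ind z : ~ outer_orbits z -> exists i, open_disc i z.
  apply: contra_notP => /forallNP zo; by exists z, [::].
have st i z : ~ outer_orbits z -> ~ outer_orbits (refl i z).
  apply: contra_not => -[x [v [xo vr zE]]].
  have [|w wr wE] := @word_refl_stable i x (refl i z); first by exists v.
  by exists x, w; split => //; rewrite -wE reflectionK.
elim: n y => [|n IH] y yo.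
  have [i [w iw <-]] := ind _ yo; exists [::]; first by rewrite mem_words.
  by exists w => //; exists i, w; split => //; exact: ltW.
have [i iy] := ind _ yo; have [v] := IH _ (st i _ yo).
rewrite mem_words => /andP[vr /eqP vn] [_ [j [z [vj jz ->]]]] zE.
have hz := word_disc d01 c_sep r_bnd vj jz.
have iv : i != head j v.
  apply/eqP => ij; apply: (reflection_inside iy (esym zE)).
  by rewrite ij.
exists (i :: v).
  have := @reduced_cons _ i j v; rewrite iv vj => /reduced_rconsW vr'.
  by rewrite mem_words vr' /= vn.
rewrite -(reflectionK i y) -zE (reflection_disc_neq iv hz).
by eexists; last reflexivity; exists j, z; rewrite reduced_cons iv vj.
Qed.

(** Points of an outer orbit come from reduced words. Those of length at most [n] form the finite
    list [L]; in a longer word, the letters after the first [n] already carry the outside point into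
    a disk. For the other orbits [L] is empty. *)
Lemma orbit_pieces x n : exists L : seq (P1 R), forall y, orbit x y ->
  y \in L \/ exists2 v, v \in words n & (Some @` piece v) y.
Proof.
have [[x' [v0 [x'o v0r ->]]]|xo] := pselect (outer_orbits x); last first.
  exists [::] => y xy; right; apply: inner_piece.
  move: y xy; apply: orbit_sub xo => i y; apply: contra_not.
  case=> x' [v [x'o vr yE]]; have [|w wr wE] := @word_refl_stable i x' (refl i y).
    by exists v.
  by exists x', w; split => //; rewrite -wE reflectionK.
exists [seq word_refl v x' | v <- flatten [seq words m | m <- iota 0 n.+1]] => y.
move=> /(@orbit_sub [set y | exists2 v, reduced v & y = word_refl v x']) [||v vr ->].
- by move=> i z; exact: word_refl_stable.
- by exists v0.
have [vn|nv] := leqP (size v) n.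
  left; apply: (@map_f _ _ (word_refl^~ x')); apply/flatten_mapP; exists (size v);
    last by rewrite mem_words vr eqxx.
  by rewrite mem_iota ltnS.
right; rewrite -(cat_take_drop n v) in vr *.
move: (size_takel (ltnW nv)); move: (take n v) vr => v1 + v1n.
case: (drop n v) (size_drop n v) => [/esym/eqP|j v2 _]; first by rewrite subn_eq0 leqNgt nv.
rewrite /word_refl foldr_cat => vr.
have vj2 : reduced (j :: v2) by case/cat_sorted2: vr.
have vj : reduced (rcons v1 j) by move: vr; rewrite -cat_rcons => /cat_sorted2[].
have [y' jy' yE] := @word_refl_outside j v2 x' x'o vj2.
exists v1; first by rewrite mem_words (reduced_rconsW vj) v1n eqxx.
rewrite [foldr _ x' _]yE [foldr _ _ _](word_refl_Some vj jy').
by eexists; last reflexivity; exists j, y'.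
Qed.

(* Infinity is left in the cover: a single point has diameter 0 and costs nothing
   for a positive exponent, so it need not be shown to lie outside the limit set. *)
Lemma limit_set_cover n (e : seq I -> R) : (forall v, 0 < e v) ->
  limit_set (generated_group (range (fun i => refl i))) `<=`
  [set None] `|` \bigcup_(v in [set` words n])
    Some @` [set w | exists2 w', piece v w' & modulus (w - w') < e v].
Proof.
move=> e0 [w|] [x _ wx]; [right|by left].
have [L HL] := orbit_pieces x n.
(* Otherwise some neighborhood of [w] avoids all pieces of level [n] and all points of [L] except
   possibly [w], hence every orbit point other than [w]. *)
apply: contrapT => /= nw.
have nearL : \forall z \near (w : R[i]^o), forall f, f \in L ->
    f != Some w -> Some (z : R[i]) <> f :> P1 R.
  apply: (@filter_forall_mem R[i]^o (P1 R) (nbhs (w : R[i]^o)) L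
    (fun f z => f != Some w -> Some z <> f) _ _) => -[a|] _; last by near=> z.
  have [->|aw] := eqVneq a w; first by near=> z; rewrite eqxx.
  apply/nbhs_modulusP; exists (modulus (w - a)).
    by rewrite modulus_gt0 subr_eq0 eq_sym.
  by move=> z + _ [za]; rewrite za ltxx.
have nearW : \forall z \near (w : R[i]^o), forall v, v \in words n -> ~ piece v z.
  apply: (@filter_forall_mem R[i]^o _ (nbhs (w : R[i]^o)) (words n)
    (fun v z => ~ piece v z) _ _) => v vn; apply/nbhs_modulusP; exists (e v) => // z wz vz.
  by apply: nw; exists v => //; exists w => //; exists z.
have [y [yw xy [z [zL zW] zy]]] : exists y : P1 R, [/\ y != Some w, orbit x y &
    (Some @` [set z : R[i]^o | (forall f, f \in L -> f != Some w -> Some z <> f) /\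
      (forall v, v \in words n -> ~ piece v z)]) y].
  apply: wx; apply: one_point_compactification_some_nbhs.
  exact: filterI.
case: (HL _ xy) => [yL|[v vn [z' vz' z'y]]]; first exact: zL yL yw zy.
by apply: (zW v vn); case: (etrans z'y (esym zy)) => <-.
Unshelve. all: by end_near. Qed.

End LimitSet.

(** * An additive mass on reduced words *)

Section WordMass.
Context {R : realType} {I : finType} (a : I -> R).
Hypotheses (a01 : forall i, 0 < a i <= 1) (sum_a : \sum_i a i / (1 + a i) = 1).

Let a_gt0 i : 0 < a i. Proof. by case/andP: (a01 i). Qed.
Let Da_gt0 i : 0 < 1 + a i. Proof. by rewrite addr_gt0. Qed.

Definition weight (v : seq I) : R := \prod_(i <- v) a i.

(** As a function of the last letter [i] this is [1 / (1 + a i)], an eigenvector for the eigenvalue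
    1 of the matrix with entries [a j] for [j != i]; as a factor it makes the weights additive. *)
Definition tail_mass (v : seq I) : R :=
  \sum_(j | reduced (rcons v j)) a j / (1 + a j).

Definition mass (v : seq I) : R := weight v * tail_mass v.

Lemma weight_rcons v j : weight (rcons v j) = weight v * a j.
Proof. by rewrite /weight big_rcons. Qed.

Lemma weight_gt0 v : 0 < weight v.
Proof. by rewrite prodr_gt0. Qed.

Lemma tail_mass_nil : tail_mass [::] = 1.
Proof. by rewrite -[RHS]sum_a; apply: eq_bigl => j. Qed.

Lemma tail_mass_rcons v j : reduced (rcons v j) ->
  tail_mass (rcons v j) = (1 + a j)^-1.
Proof.
move=> vj; transitivity (\sum_(i | i != j) a i / (1 + a i)).
  by apply: eq_bigl => i; rewrite reduced_rcons vj eq_sym.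
have := sum_a; rewrite (bigD1 j) //= => /(canRL (addKr _)) ->.
have := Da_gt0 j; move: (a j) => b b0; field; exact: lt0r_neq0.
Qed.

Lemma tail_mass_bounds v : reduced v -> 1 / 2 <= tail_mass v <= 1.
Proof.
elim/last_ind: v => [|v j _ vj].
  by move=> _; rewrite tail_mass_nil; apply/andP; split; lra.
rewrite tail_mass_rcons //; case/andP: (a01 j) => a0 a1; have Da := Da_gt0 j.
rewrite invf_le1 // div1r lef_pV2 ?posrE //; apply/andP; split; lra.
Qed.

Lemma mass_nil : mass [::] = 1.
Proof. by rewrite /mass tail_mass_nil /weight big_nil mulr1. Qed.

Lemma mass_bounds v : reduced v -> weight v / 2 <= mass v <= weight v.
Proof.
move=> /tail_mass_bounds/andP[t1 t2]; have w0 := weight_gt0 v.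
by rewrite /mass; apply/andP; split; nra.
Qed.

Lemma mass_split v : mass v = \sum_(j | reduced (rcons v j)) mass (rcons v j).
Proof.
rewrite /mass mulr_sumr; apply: eq_bigr => j vj.
by rewrite tail_mass_rcons // weight_rcons mulrA.
Qed.

Lemma sum_mass_words n : \sum_(v <- words n) mass v = 1.
Proof.
elim: n => [|n IH]; first by rewrite big_seq1 mass_nil.
rewrite -[RHS]IH big_allpairs_dep; apply: eq_bigr => v _.
by rewrite big_filter big_enum_cond mass_split.
Qed.

(** The masses of level [n] add up to 1, and a weight is at most twice the mass. *)
Lemma sum_weight_words n : \sum_(v <- words n) weight v <= 2.
Proof.
rewrite (_ : 2 = \sum_(v <- @words I n) 2 * mass v); last first.
  by rewrite -mulr_sumr sum_mass_words mulr1.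
rewrite big_seq [leRHS]big_seq; apply: ler_sum => v.
by rewrite mem_words => /andP[/mass_bounds/andP[+ _] _]; lra.
Qed.

End WordMass.

Lemma powR_prod {R : realType} {I : Type} (v : seq I) (f : I -> R) s :
  (forall i, 0 <= f i) -> (\prod_(i <- v) f i) `^ s = \prod_(i <- v) f i `^ s.
Proof.
move=> f0; elim: v => [|i v IH]; first by rewrite !big_nil powR1.
by rewrite !big_cons powRM ?IH // prodr_ge0.
Qed.

(** * Hausdorff content and dimension bounded by finite covers *)

Section HausdorffUpper.
Context {R : realType} {T : Type} (d : T -> T -> R).

Lemma diameter_le (U : set T) (e : R) :
  (forall x y, U x -> U y -> d x y <= e) -> (diameter d U <= e%:E)%E.
Proof.
move=> Ue; apply: ge_ereal_sup => _ [[x y] [/= Ux Uy] <-].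
by rewrite lee_fin Ue.
Qed.

Lemma diameter_ge (U : set T) x y : U x -> U y -> ((d x y)%:E <= diameter d U)%E.
Proof. by move=> Ux Uy; apply: ereal_sup_ubound; exists (x, y). Qed.

Hypothesis (dxx : forall x, d x x = 0).

Lemma diameter_powR_le (U : set T) (e s : R) : 0 < s -> 0 <= e ->
  (forall x y, U x -> U y -> d x y <= e) -> (diameter d U `^ s <= (e `^ s)%:E)%E.
Proof.
move=> s0 e0 /diameter_le Ue; have [U0|/set0P[x Ux]] := eqVneq U set0.
  (* The empty set has diameter [-oo], whose power with nonzero exponent is 0. *)
  suff -> : diameter d U = -oo%E by rewrite poweRNyr ?gt_eqF ?lee_fin ?powR_ge0.
  by rewrite /diameter U0 set0X image_set0 ereal_sup0.
have dU : (0 <= diameter d U)%E by apply: le_trans (diameter_ge Ux Ux); rewrite dxx.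
rewrite -poweR_EFin; apply: gt0_ler_poweR; rewrite ?(ltW s0) // in_itv /= leey andbT.
  exact: dU.
by rewrite lee_fin.
Qed.

Lemma hausdorff_content_le_sum (delta s : R) (A : set T) {J : eqType} (L : seq J)
    (V : J -> set T) (e : J -> R) : 0 < s ->
  A `<=` \bigcup_(j in [set` L]) V j ->
  (forall j, j \in L -> 0 <= e j <= delta) ->
  (forall j x y, j \in L -> V j x -> V j y -> d x y <= e j) ->
  (hausdorff_content d delta s A <= (\sum_(j <- L) e j `^ s)%:E)%E.
Proof.
(* The finite cover is prolonged to a sequence by empty sets, which the sum leaves out. *)
move=> s0 AV eL Ve; pose U := nth set0 [seq V j | j <- L].
have U0 i : (size L <= i)%N -> U i = set0.
  by move=> Li; rewrite /U nth_default // size_map.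
have d0 i : (0 <= diameter d (U i) `^ s)%E by exact: poweR_ge0.
apply: (@le_trans _ _ (\sum_(0 <= i <oo | U i != set0) diameter d (U i) `^ s)%E).
  apply: ereal_inf_lbound; exists U => //; split.
    move=> x /AV[j jL Vx]; exists (index j L) => //=.
    by rewrite /U (nth_map j) ?index_mem // nth_index.
  move=> i; apply: diameter_le => x y; have [Li|iL] := leqP (size L) i.
    by rewrite U0.
  case: L iL @U U0 d0 eL Ve AV => // j0 L iL U U0 d0 eL Ve AV.
  rewrite /U (nth_map j0) // => Vx Vy.
  have jL := mem_nth j0 iL; apply: le_trans (Ve _ _ _ jL Vx Vy) _.
  by case/andP: (eL _ jL).
rewrite eseries_mkcond (nneseries_split _ (size L)); last first.
  by move=> k _; case: ifP.
rewrite add0n (@eseries0 _ _ _ xpredT) ?adde0; last first.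
  by move=> i Li _; rewrite U0 // eqxx.
have dL j : j \in L -> (diameter d (V j) `^ s <= (e j `^ s)%:E)%E.
  move=> jL; apply: diameter_powR_le => // [|x y]; last exact: Ve.
  by case/andP: (eL _ jL).
clear U0 d0; rewrite -sumEFin {}/U; case: L dL {AV eL Ve} => [|j0 L] dL.
  by rewrite big_geq // big_nil.
rewrite [leRHS](big_nth j0) !big_mkord; apply: lee_sum => i _.
rewrite (nth_map j0) //; case: ifP => _; last by rewrite lee_fin powR_ge0.
exact/dL/mem_nth.
Qed.

Lemma hausdorff_dim_le (s : R) (A : set T) : 0 <= s ->
  (forall delta e : R, 0 < delta -> 0 < e -> (hausdorff_content d delta s A <= e%:E)%E) ->
  (hausdorff_dim d A <= s%:E)%E.
Proof.
move=> s0 Ae; apply: ereal_inf_lbound; exists s => //; split => //.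
apply/eqP; rewrite eq_le; apply/andP; split.
  apply: ge_ereal_sup => _ [delta delta0 <-]; apply/lee_addgt0Pr => e e0.
  by rewrite add0e Ae.
apply: le_ereal_sup_tmp; exists (hausdorff_content d 1 s A); first by exists 1; first exact: ltr01.
apply: le_ereal_inf_tmp => _ [U _ <-]; apply: nneseries_ge0 => i _ _.
exact: poweR_ge0.
Qed.

End HausdorffUpper.

(** * Upper bound for the dimension of the limit set *)

Section LimitSetUpper.
Context {R : realType} {I : finType} (c : I -> R[i]) (r : I -> R) (d : R).
Hypotheses (d01 : 0 < d <= 1) (c1 : forall i, modulus (c i) = 1)
  (c_sep : forall i j, i != j -> d <= modulus (c i - c j))
  (r_bnd : forall i, 0 < r i <= d / 4).
Context (a : I -> R).
Hypotheses (a01 : forall i, 0 < a i <= 1) (sum_a : \sum_i a i / (1 + a i) = 1).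

(** The s-th powers of the sizes of the pieces of level [n] sum to at most a constant times
    [theta ^+ n] times the total weight, which is at most 2; this tends to 0. *)
Lemma hausdorff_dim_limit_set_le (s theta : R) : 0 < s -> 0 < theta < 1 ->
  (forall i, lipc r d i `^ s <= theta * a i) ->
  (hausdorff_dim spherical_dist (limit_set
     (generated_group (range (fun i => reflection (c i) (r i))))) <= s%:E)%E.
Proof.
move=> s0 /andP[t0 t1] lip; apply: hausdorff_dim_le => [|delta e delta0 e0].
  exact: ltW.
pose tau v := \prod_(i <- v) lipc r d i.
have tau0 v : 0 < tau v by rewrite prodr_gt0 // => i _; exact: lipc_gt0.
have tauX v : tau v `^ s <= theta ^+ size v * weight a v.
  rewrite powR_prod => [|i]; last exact/ltW/lipc_gt0.
  elim: v => [|i v IH]; first by rewrite /weight !big_nil mulr1.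
  rewrite /weight !big_cons exprS mulrACA ler_pM ?powR_ge0 //.
  by rewrite prodr_ge0 // => j _; rewrite powR_ge0.
pose piece_nbhs v :=
  [set w | exists2 w', piece c r v w' & modulus (w - w') < tau v].
(* The 6 is 4 for the largest distance between points of the disks, plus 1 for each enlargement by
   [tau v]. *)
have dist_nbhs v w w' : piece_nbhs v w -> piece_nbhs v w' ->
    modulus (w - w') <= 6 * tau v.
  move=> [p [j [y [vj jy ->]]] wp] [p' [j' [y' [vj' jy' ->]]] wp'].
  have /andP[_] := word_bilip d01 c1 c_sep r_bnd vj vj' jy jy'.
  have yy' := disc_dist_le d01 c1 r_bnd jy jy'.
  rewrite -/(tau v) => pp'; have {}yy' := ler_wpM2l (ltW (tau0 v)) yy'.
  have := modulus_dist w w' (foldr (inversion c r) y v).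
  have := modulus_dist (foldr (inversion c r) y v) w' (foldr (inversion c r) y' v).
  by rewrite (modulusC (foldr _ y' v) w'); lra.
have cvg_tau (q K b : R) : 0 < q < 1 -> 0 < K -> 0 < b ->
    \forall n \near \oo, K * q ^+ n <= b.
  move=> /andP[q0 q1] K0 b0.
  have := @cvg_geometric R K q; rewrite gtr0_norm // => /(_ q1).
  move=> /cvgr0_norm_le /(_ b b0); apply: filterS => n.
  exact/le_trans/ler_norm.
(* The three conditions make [spherical_dist_le] applicable, the spherical diameters at most [delta]
   (24 is 4 times 6), and the sum at most [e]. *)
have [n [n1 n2 n3]] : exists n, [/\ 6 * (9 / 16) ^+ n <= 1 / 2 :> R,
    24 * (9 / 16) ^+ n <= delta :> R & 24 `^ s * 2 * theta ^+ n <= e].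
  have : \forall n \near \oo, [/\ 6 * (9 / 16) ^+ n <= 1 / 2 :> R,
    24 * (9 / 16) ^+ n <= delta & 24 `^ s * 2 * theta ^+ n <= e].
    by near=> n; split; near: n; apply: cvg_tau => //;
      rewrite ?mulr_gt0 ?powR_gt0 ?t0 //=; lra.
  by case=> N _ HN; exists N; exact: HN (leqnn N).
pose V (o : option (seq I)) : set (P1 R) :=
  if o is Some v then Some @` piece_nbhs v else [set None].
pose E (o : option (seq I)) : R := if o is Some v then 24 * tau v else 0.
have tau_n v : v \in words n -> tau v <= (9 / 16) ^+ n.
  by rewrite mem_words => /andP[_ /eqP <-]; exact: prod_lipc_le.
apply: le_trans (@hausdorff_content_le_sum _ _ _ spherical_distxx delta s _ _
  (None :: [seq Some v | v <- words n]) V E s0 _ _ _) _.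
- move=> x /(limit_set_cover d01 c_sep r_bnd n tau0)[->|[v vn vx]].
    by exists None.
  by exists (Some v) => //=; rewrite inE /= mem_map // => ? ? [].
- move=> j; rewrite inE => /orP[/eqP-> /=|/mapP[v vn -> /=]]; first by rewrite lexx ltW.
  rewrite mulr_ge0 ?(ltW (tau0 v)) //=; apply: le_trans n2.
  by rewrite ler_pM2l // tau_n.
- move=> j x y; rewrite inE => /orP[/eqP-> /= -> ->|/mapP[v vn -> /=]].
    by rewrite spherical_distxx.
  move=> [w vw <-] [w' vw' <-]; have ww' := dist_nbhs _ _ _ vw vw'.
  have := tau_n v vn; have := @spherical_dist_le _ w w'; lra.
rewrite lee_fin big_cons /= powR0 ?gt_eqF // add0r big_map /=.
apply: le_trans n3; rewrite -!mulrA.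
apply: (@le_trans _ _ (24 `^ s * (theta ^+ n * \sum_(v <- words n) weight a v))).
  rewrite !mulr_sumr big_seq [leRHS]big_seq; apply: ler_sum => v.
  rewrite mem_words => /andP[_ /eqP vn].
  by rewrite powRM ?(ltW (tau0 v)) // ler_pM2l ?powR_gt0 // -vn tauX.
rewrite ler_pM2l ?powR_gt0 // mulrC ler_pM2r ?exprn_gt0 //.
exact: sum_weight_words.
Unshelve. all: by end_near. Qed.

End LimitSetUpper.

(** * A branch of the word tree that escapes a small covering *)

Section AvoidingPath.
Context {R : realType} {I : finType} (m : seq I -> R).
Hypotheses (m_ge0 : forall v, 0 <= m v)
  (m_split : forall v, reduced v -> m v = \sum_(j | reduced (rcons v j)) m (rcons v j)).
Context (hit : nat -> seq I -> Prop) (q : nat -> \bar R).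
Hypotheses (q_ge0 : forall i, (0 <= q i)%E) (sum_q : (\sum_(0 <= i <oo) q i < (m [::])%:E)%E)
  (hitW : forall i v j, hit i (rcons v j) -> hit i v)
  (hit_branch : forall i v j j', j != j' -> reduced (rcons v j) ->
     reduced (rcons v j') -> hit i (rcons v j) -> hit i (rcons v j') ->
     ((m v)%:E <= q i)%E).

(* The share of the mass of [v] that the i-th covering set can account for; it
   is at least the sum of the shares of the extensions of [v] by one letter. *)
Let load i v : \bar R := if `[< hit i v >] then Order.min (q i) (m v)%:E else 0%E.

Let load_ge0 i v : (0 <= load i v)%E.
Proof. by rewrite /load; case: ifP => // _; rewrite le_min q_ge0 lee_fin m_ge0. Qed.

Let load_le_mass i v : (load i v <= (m v)%:E)%E.
Proof.
by rewrite /load; case: ifP => _; rewrite ?lee_fin ?m_ge0 // ge_min lexx orbT.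
Qed.

Let load_rcons i v j : reduced (rcons v j) -> (load i (rcons v j) <= load i v)%E.
Proof.
move=> vj; rewrite {1}/load; case: ifPn => [/asboolP h|_]; last exact: load_ge0.
rewrite /load ifT; last exact/asboolP/hitW/h.
rewrite le_min !ge_min lexx /= lee_fin (m_split (reduced_rconsW vj)).
by rewrite (bigD1 j) //= lerDl sumr_ge0 ?orbT.
Qed.

(** If two extensions of [v] are hit, [hit_branch] makes the load of [v] its whole mass; otherwise
    at most one term of the sum is nonzero. *)
Let load_split i v : reduced v ->
  (\sum_(j | reduced (rcons v j)) load i (rcons v j) <= load i v)%E.
Proof.
move=> vr.
have [[j vj hj]|nohit] :=
  pselect (exists2 j, reduced (rcons v j) & hit i (rcons v j)); last first.
  rewrite big1 ?load_ge0 // => j vj; rewrite /load ifF //.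
  by apply/asboolP => h; apply: nohit; exists j.
have [[j' /andP[vj' jj'] hj']|onehit] := pselect (exists2 j',
    reduced (rcons v j') && (j' != j) & hit i (rcons v j')).
  have mq := hit_branch jj' vj' vj hj' hj.
  rewrite {2}/load ifT; last exact/asboolP/hitW/hj.
  rewrite min_r // (m_split vr) -sumEFin; apply: lee_sum => k _.
  exact: load_le_mass.
rewrite (bigD1 j) //= [X in (_ + X)%E]big1 ?adde0 ?load_rcons // => k vk.
by rewrite /load ifF //; apply/asboolP => h; apply: onehit; exists k.
Qed.

Let underloaded v := reduced v /\ (\sum_(0 <= i <oo) load i v < (m v)%:E)%E.

Let underloaded_nil : underloaded [::].
Proof.
split=> //; apply: le_lt_trans sum_q; apply: lee_nneseries => i _ //.
by rewrite /load; case: ifP => // _; rewrite ge_min lexx.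
Qed.

(** If every reduced extension carried a load of at least its mass, summing over the extensions
    would give a load of at least [m v] at [v]. *)
Let underloaded_rcons v : underloaded v -> exists j, underloaded (rcons v j).
Proof.
case=> vr; apply: contraPP => /forallNP no; apply/negP; rewrite -leNgt.
have step j : reduced (rcons v j) ->
    ((m (rcons v j))%:E <= \sum_(0 <= i <oo) load i (rcons v j))%E.
  by move=> vj; rewrite leNgt; apply/negP => lt; apply: (no j).
rewrite (m_split vr) -sumEFin; apply: le_trans (lee_sum _ step) _.
rewrite -nneseries_sum // ; apply: lee_nneseries => i _ //.
  by rewrite sume_ge0.
exact: load_split.
Qed.

(** Meant for [hit i v] saying that the i-th covering set contains a limit point of an infinite word
    beginning with [v], and [q i] a slightly enlarged power of its diameter. *)
Lemma avoiding_path : exists w : nat -> I, forall n,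
  reduced (mkseq w n) /\
  forall i, hit i (mkseq w n) -> (q i < (m (mkseq w n))%:E)%E.
Proof.
(* This letter only serves as a default value for the choice function. *)
have [j0 _] := underloaded_rcons underloaded_nil.
have /choice[f Hf] : forall v, exists j, underloaded v -> underloaded (rcons v j).
  move=> v; have [/underloaded_rcons[j vj]|nv] := pselect (underloaded v).
    by exists j.
  by exists j0.
pose V n := iter n (fun v => rcons v (f v)) [::].
have V_under n : underloaded (V n) by elim: n => //= n; exact: Hf.
exists (f \o V) => n; have -> : mkseq (f \o V) n = V n.
  by elim: n => // n IH; rewrite mkseqS IH.
have [vr vload] := V_under n; split=> // i h.
(* Otherwise the load of the single index [i] would be the full mass. *)
rewrite ltNge; apply/negP => qm; move: vload; apply/negP; rewrite -leNgt.
have -> : (m (V n))%:E = load i (V n).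
  by rewrite /load ifT; [rewrite min_r|exact/asboolP].
by rewrite (@nneseriesD1 _ _ i) // leeDl // nneseries_ge0.
Qed.

End AvoidingPath.

(** * Limits of sequences with an explicit rate *)

Lemma limit_with_rate {R : realType} (u e : nat -> R) : (forall n, 0 <= e n) ->
  (forall n N, (n <= N)%N -> `|u N - u n| <= e n) ->
  exists x, forall n, `|x - u n| <= e n.
Proof.
(* The limit is the supremum of the lower bounds [u n - e n]. *)
move=> e0 ue; pose E := [set u n - e n | n in [set: nat]].
have uE k : ubound E (u k + e k).
  move=> _ [n _ <-]; case: (leqP n k) => [/ue|/ltnW/ue]; rewrite ler_norml.
    by have := e0 k; lra.
  by have := e0 n; lra.
have E0 : E !=set0 by exists (u 0%N - e 0%N), 0%N.
exists (sup E) => n; have := ge_sup E0 (uE n).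
have : u n - e n <= sup E by apply: ub_le_sup; [exists (u n + e n)|exists n].
by rewrite ler_norml => ? ?; apply/andP; split; lra.
Qed.

(** The factor 2 adds the errors of the real and the imaginary part. *)
Lemma limit_with_rate_complex {R : realType} (u : nat -> R[i]) (e : nat -> R) :
  (forall n, 0 <= e n) ->
  (forall n N, (n <= N)%N -> modulus (u N - u n) <= e n) ->
  exists x, forall n, modulus (x - u n) <= 2 * e n.
Proof.
move=> e0 ue.
have [|x xu] := @limit_with_rate _ (fun n => complex.Re (u n)) _ e0.
  move=> n N /ue; apply: le_trans.
  by rewrite -[X in `|X|](raddfB (@complex.Re R : Rcomplex R -> R)) Re_le_modulus.
have [|y yu] := @limit_with_rate _ (fun n => complex.Im (u n)) _ e0.
  move=> n N /ue; apply: le_trans.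
  by rewrite -[X in `|X|](raddfB (@complex.Im R : Rcomplex R -> R)) Im_le_modulus.
exists (Complex x y) => n; apply: le_trans (modulus_le_ReIm _) _.
have := xu n; have := yu n; case: (u n) => a b /=; lra.
Qed.

(** * Limit points of infinite words and the lower bound for the dimension *)

Section LimitSetLower.
Context {R : realType} {I : finType} (c : I -> R[i]) (r : I -> R) (d : R).
Hypotheses (d01 : 0 < d <= 1) (c1 : forall i, modulus (c i) = 1)
  (c_sep : forall i j, i != j -> d <= modulus (c i - c j))
  (r_bnd : forall i, 0 < r i <= d / 4).

Local Notation inv := (inversion c r).
Local Notation disc := (disc c r).
Local Notation Gamma :=
  (generated_group (range (fun i => reflection (c i) (r i)))).

Definition infinite_path (w : nat -> I) := forall n, reduced (mkseq w n).

(** The image of infinity under the first [n.+1] reflections of the path, since the reflection with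
    index [w n] sends infinity to [c (w n)]. *)
Definition path_point (w : nat -> I) n := foldr inv (c (w n)) (mkseq w n).

(** The 8 is 4, bounding distances between points of the disks, times the 2 of
    [limit_with_rate_complex]. *)
Definition path_limit (w : nat -> I) (x : R[i]) :=
  forall n, modulus (x - path_point w n) <= 8 * (9 / 16) ^+ n.

Lemma geometric_small (K e : R) : 0 < K -> 0 < e ->
  exists n, forall k, (n <= k)%N -> K * (9 / 16) ^+ k < e.
Proof.
move=> K0 e0; have := @cvg_geometric R K (9 / 16).
rewrite ger0_norm ?divr_ge0 // => /(_ _) h.
have {h}/cvgr0_norm_lt /(_ e e0) [N _ HN] := h ltac:(lra).
by exists N => k /HN; apply/le_lt_trans/ler_norm.
Qed.

Lemma infinite_path_neq w n : infinite_path w -> w n != w n.+1.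
Proof. by move=> /(_ n.+2); rewrite !mkseqS reduced_rcons => /andP[]. Qed.

Lemma infinite_path_step w n y : infinite_path w -> disc (w n.+1) y ->
  disc (w n) (inv (w n) y).
Proof.
by move=> wp; apply: (inversion_disc_neq d01 c_sep r_bnd); exact: infinite_path_neq.
Qed.

(** The letters from index [n] on carry the last center back into the disk of [w n]. *)
Lemma path_point_head w n N : infinite_path w -> (n <= N)%N ->
  exists2 y, disc (w n) y & path_point w N = foldr inv y (mkseq w n).
Proof.
move=> wp /subnKC <-; rewrite /path_point.
have := disc_center c r_bnd (w (n + (N - n))%N).
elim: (N - n)%N (c _) => [|m IH] y; rewrite ?addn0 ?addnS => wy; first by exists y.
by rewrite mkseqS foldr_rcons; apply/IH/infinite_path_step.
Qed.

Lemma path_limit_exists w : infinite_path w -> exists x, path_limit w x.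
Proof.
move=> wp; have [n|n N nN|x xw] :=
    @limit_with_rate_complex _ (path_point w) (fun n => 4 * (9 / 16) ^+ n).
- by rewrite mulr_ge0 ?exprn_ge0 ?divr_ge0.
- have [y wy ->] := path_point_head wp nN.
  have [y' wy' ->] := path_point_head wp (leqnn n).
  have wr : reduced (rcons (mkseq w n) (w n)) by rewrite -mkseqS.
  have /andP[_] := word_bilip d01 c1 c_sep r_bnd wr wr wy wy'.
  move=> /le_trans; apply; rewrite mulrC ler_pM ?modulus_ge0 //.
  - by rewrite prodr_ge0 // => i _; exact/ltW/lipc_gt0.
  - exact: (disc_dist_le d01 c1 r_bnd wy wy').
  - by rewrite -[X in _ ^+ X](size_mkseq w n); exact: prod_lipc_le.
- by exists x => n; have := xw n; rewrite mulrA -natrM.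
Qed.

Lemma path_limit_modulus w x : infinite_path w -> path_limit w x -> modulus x <= 2.
Proof.
(* The disks lie within modulus [5 / 4], which leaves [3 / 4] for the error. *)
move=> wp wx; have [|//|n /(_ n (leqnn n)) hn] := @geometric_small 8 (3 / 4).
  by lra.
have [y wy yE] := path_point_head wp (leq0n n).
have := disc_modulus_le d01 c1 r_bnd wy; have := wx n; rewrite yE /=.
by have := modulusD (x - y) y; rewrite subrK; lra.
Qed.

(** An inversion does not send a point of another disk to its center, and the lower Lipschitz bound
    keeps distinct points distinct. Hence of two consecutive path points at least one differs from
    the limit. *)
Lemma path_point_neq w n : infinite_path w -> path_point w n != path_point w n.+1.
Proof.
move=> wp; have wy := disc_center c r_bnd (w n).
have wy' := infinite_path_step wp (disc_center c r_bnd (w n.+1)).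
have wr : reduced (rcons (mkseq w n) (w n)) by rewrite -mkseqS.
have /andP[h _] := word_bilip d01 c1 c_sep r_bnd wr wr wy wy'.
rewrite -subr_eq0 -modulus_gt0 /path_point mkseqS foldr_rcons.
apply: lt_le_trans h; rewrite mulr_gt0 ?prodr_gt0 // => [i _|].
  exact: colipc_gt0.
rewrite modulus_gt0 /inversion opprD addNKr oppr_eq0 mulf_neq0 //.
  rewrite (inj_eq (@complexI R) _ 0) expf_neq0 ?gt_eqF //.
  by case/andP: (r_bnd (w n)).
rewrite invr_eq0 conjc_eq0 subr_eq0.
apply: (disc_neq_center d01 c_sep r_bnd _ (disc_center c r_bnd _)).
exact: infinite_path_neq.
Qed.

Lemma path_point_orbit w n : infinite_path w ->
  orbit_of Gamma None (Some (path_point w n)).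
Proof.
move=> wp; have wr : reduced (rcons (mkseq w n) (w n)) by rewrite -mkseqS.
rewrite -(word_refl_Some d01 c_sep r_bnd wr (disc_center c r_bnd _)).
have := word_refl_orbit c r (rcons (mkseq w n) (w n)) None.
by rewrite /word_refl foldr_rcons.
Qed.

Lemma path_limit_limit_set w x : infinite_path w -> path_limit w x ->
  limit_set Gamma (Some x).
Proof.
move=> wp wx; exists None => // U Ux.
have /nbhs_modulusP[e e0 eU] : nbhs (x : R[i]^o) (Some @^-1` U) by exact: Ux.
have [//|n hn] := @geometric_small 8 e _ e0.
have pU k : (n <= k)%N -> U (Some (path_point w k)).
  by move=> nk; apply: eU; apply: le_lt_trans (wx k) (hn k nk).
have [xn|xn] := eqVneq (path_point w n) x.
  exists (Some (path_point w n.+1)); split; [|exact: path_point_orbit|exact: pU].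
  by rewrite -xn (inj_eq Some_inj) eq_sym path_point_neq.
exists (Some (path_point w n)); split; [|exact: path_point_orbit|exact: pU].
by rewrite (inj_eq Some_inj).
Qed.

(** Disks [j] and [j'] are [d / 2] apart, [v] shrinks this at most by the product of the [colipc],
    and passing to the spherical distance costs the factor 5. *)
Lemma path_limit_separated v j j' w w' x x' : j != j' ->
    infinite_path w -> mkseq w (size v).+1 = rcons v j -> path_limit w x ->
    infinite_path w' -> mkseq w' (size v).+1 = rcons v j' -> path_limit w' x' ->
  (\prod_(i <- v) colipc r d i) * (d / 10) <= spherical_dist (Some x) (Some x').
Proof.
move=> jj' wp wv wx wp' wv' wx'.
have := spherical_dist_ge (path_limit_modulus wp wx) (path_limit_modulus wp' wx').
apply: le_trans; rewrite (_ : d / 10 = (d / 2) / 5); last by field.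
rewrite mulrA ler_wpM2r //; apply/ler_addgt0Pr => e e0.
(* Each limit is within [8 * (9 / 16) ^+ N] of its path point, so both errors together have the
   constant 16. *)
have [//|n hn] := @geometric_small 16 e _ e0.
pose N := maxn n (size v).
have {}hn : 16 * (9 / 16) ^+ N < e by apply: hn; exact: leq_maxl.
have vN : (size v <= N)%N by exact: leq_maxr.
have [vE wj] : mkseq w (size v) = v /\ w (size v) = j.
  by move: wv; rewrite mkseqS => /rcons_inj[].
have [vE' wj'] : mkseq w' (size v) = v /\ w' (size v) = j'.
  by move: wv'; rewrite mkseqS => /rcons_inj[].
have [y wy yE] := path_point_head wp vN.
have [y' wy' yE'] := path_point_head wp' vN.
rewrite vE wj in wy yE; rewrite vE' wj' in wy' yE'.
have vj : reduced (rcons v j) by rewrite -wv; exact: wp.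
have vj' : reduced (rcons v j') by rewrite -wv'; exact: wp'.
have /andP[+ _] := word_bilip d01 c1 c_sep r_bnd vj vj' wy wy'.
rewrite -yE -yE' => h; have dy := disc_dist_ge c_sep r_bnd jj' wy wy'.
have prod0 : 0 <= \prod_(i <- v) colipc r d i.
  by rewrite prodr_ge0 // => i _; exact/ltW/colipc_gt0.
have {dy}dy := ler_wpM2l prod0 dy.
have := modulus_dist (path_point w N) (path_point w' N) x.
have := modulus_dist x (path_point w' N) x'.
have := wx N; have := wx' N; rewrite (modulusC x (path_point w N)).
by lra.
Qed.

Context (a : I -> R) (alpha : R).
Hypotheses (a_bnd : forall i, 0 < a i <= alpha) (alpha1 : alpha < 1)
  (sum_a : \sum_i a i / (1 + a i) = 1).

Lemma hausdorff_dim_limit_set_ge (s : R) : (forall i, a i <= colipc r d i `^ s) ->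
  (s%:E <= hausdorff_dim spherical_dist (limit_set Gamma))%E.
Proof.
move=> colip; apply: le_ereal_inf_tmp => _ [t [t0 Ht0] <-].
rewrite lee_fin leNgt; apply/negP => ts.
have a01 i : 0 < a i <= 1.
  by case/andP: (a_bnd i) => -> ai; apply: le_trans ai (ltW alpha1).
have a_gt0 i : 0 < a i by case/andP: (a01 i).
case/andP: (d01) => d0 d1.
(* By [path_limit_separated], [K] times the mass of [v] is at most the s-th power of the diameter of
   a set meeting two branches at [v]. *)
pose K : R := (d / 10) `^ s.
have K0 : 0 < K by rewrite powR_gt0 ?divr_gt0.
have K2 : 0 < K / 2 by rewrite divr_gt0.
have content_lt : (hausdorff_content spherical_dist 1 t (limit_set Gamma)
    < (K / 2)%:E)%E.
  apply: (@le_lt_trans _ _ 0%E); last by rewrite lte_fin.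
  by rewrite -Ht0; apply: ereal_sup_ubound; exists 1; first exact: ltr01.
have [_ [U [UA U1] <-] Ulo] := ereal_inf_lt content_lt.
(* The added terms sum to at most [K / 2], so the total stays below [K]; they keep each [q i]
   positive, even for a set of diameter 0. *)
pose q i : \bar R := ((if U i != set0 then diameter spherical_dist (U i) `^ t else 0)
  + (K / 2 / (2 ^ i.+1)%:R)%:E)%E.
have Ut0 i : (0 <= if U i != set0 then diameter spherical_dist (U i) `^ t else 0)%E.
  by case: ifP => // _; exact: poweR_ge0.
have q0 i : (0 <= q i)%E by rewrite adde_ge0 // lee_fin divr_ge0 ?ltW.
pose hit i v := exists w x, [/\ infinite_path w, path_limit w x,
  mkseq w (size v) = v & U i (Some x)].
have m_ge0 v : 0 <= K * mass a v.
  rewrite mulr_ge0 ?(ltW K0) // mulr_ge0 ?(ltW (weight_gt0 a01 _)) // sumr_ge0 //.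
  by move=> i _; rewrite divr_ge0 ?addr_ge0 // ltW.
have m_split v : reduced v ->
    K * mass a v = \sum_(j | reduced (rcons v j)) K * mass a (rcons v j).
  by move=> _; rewrite -mulr_sumr -(mass_split a01 sum_a).
have sum_q : (\sum_(0 <= i <oo) q i < (K * mass a [::])%:E)%E.
  rewrite (mass_nil sum_a) mulr1; have := @epsilon_trick R _ (K / 2) xpredT Ut0 (ltW K2).
  move=> /le_lt_trans; apply; rewrite -eseries_mkcond.
  by rewrite (_ : K%:E = (K / 2)%:E + (K / 2)%:E)%E ?lteD2rE // -EFinD -splitr.
have hitW i v j : hit i (rcons v j) -> hit i v.
  move=> [w [x [wp wx]]]; rewrite size_rcons mkseqS => /rcons_inj[wv _] Ux.
  by exists w, x.
have prod_colipc v : 0 < \prod_(i <- v) colipc r d i <= 1.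
  rewrite prodr_gt0 => [|i _]; last exact: colipc_gt0.
  rewrite prodr_ile1 // => i _; rewrite (ltW (colipc_gt0 d01 r_bnd i)) /=.
  by have := colipc_le r d01 i; have := lipc_le d01 r_bnd i; lra.
have hit_branch i v j j' : j != j' -> reduced (rcons v j) -> reduced (rcons v j') ->
    hit i (rcons v j) -> hit i (rcons v j') -> ((K * mass a v)%:E <= q i)%E.
  move=> jj' vj vj' [w [x [wp wx wv Ux]]] [w' [x' [wp' wx' wv' Ux']]].
  rewrite !size_rcons in wv wv'; case/andP: (prod_colipc v) => p0 p1.
  apply: (@le_trans _ _ (diameter spherical_dist (U i) `^ t)%E); last first.
    rewrite /q ifT ?leeDl ?lee_fin ?divr_ge0 ?ltW //.
    by apply/set0P; exists (Some x).
  have := path_limit_separated jj' wp wv wx wp' wv' wx'.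
  set b := _ * _ => bx.
  have b0 : 0 < b by rewrite mulr_gt0 ?divr_gt0.
  have b1 : b <= 1 by rewrite mulr_ile1 // ?ltW ?divr_gt0 //; lra.
  apply: (@le_trans _ _ (b%:E `^ t)%E); last first.
    have bU : (b%:E <= diameter spherical_dist (U i))%E.
      by apply: le_trans (diameter_ge spherical_dist Ux Ux'); rewrite lee_fin.
    apply: gt0_ler_poweR => //; rewrite in_itv /= leey andbT ?lee_fin ?ltW //.
    by apply: lt_le_trans bU; rewrite lte_fin.
  (* Since [b <= 1] and [t < s], the power with exponent [t] is the larger one. *)
  rewrite poweR_EFin lee_fin; apply: (@le_trans _ _ (b `^ s)); last first.
    by apply: ger_powR; rewrite ?b0 // ltW.
  rewrite /b powRM ?(ltW p0) ?divr_ge0 ?(ltW d0) // mulrC ler_wpM2r ?(ltW K0) //.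
  case/andP: (mass_bounds a01 sum_a (reduced_rconsW vj)) => _ /le_trans; apply.
  rewrite powR_prod => [|k]; last exact/ltW/colipc_gt0.
  by apply: ler_prod => k _; rewrite colip ltW.
have [w wq] := avoiding_path m_ge0 m_split q0 sum_q hitW hit_branch.
have wp : infinite_path w by move=> n; case: (wq n).
have [x wx] := path_limit_exists wp.
(* Some [U i] covers the limit of the avoiding path and so hits all its prefixes: [q i] would lie
   below masses tending to 0, yet it is bounded below by its added term. *)
have [i _ Ux] := UA _ (path_limit_limit_set wp wx).
have hit_w n : hit i (mkseq w n) by exists w, x; rewrite size_mkseq.
have weight_le n : weight a (mkseq w n) <= alpha ^+ n.
  rewrite -[X in _ ^+ X](size_mkseq w n) /weight; elim: (mkseq w n) => [|j v IH].
    by rewrite big_nil.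
  rewrite big_cons exprS ler_pM ?(ltW (weight_gt0 a01 _)) ?(ltW (a_gt0 j)) //.
  by case/andP: (a_bnd j).
have alpha0 : 0 < alpha by case/andP: (a_bnd (w 0%N)) => /lt_le_trans; apply.
have := @cvg_geometric R K alpha; rewrite gtr0_norm // => /(_ alpha1).
move=> /cvgr0_norm_lt /(_ (K / 2 / (2 ^ i.+1)%:R)) [|N _ HN].
  by rewrite divr_gt0 ?ltr0n ?expn_gt0.
have [wr /(_ _ (hit_w N))] := wq N; apply/negP; rewrite -leNgt.
apply: (@le_trans _ _ (K / 2 / (2 ^ i.+1)%:R)%:E); last by rewrite /q leeDr.
rewrite lee_fin; apply: le_trans (ltW (HN N (leqnn N))).
apply: le_trans (ler_norm _); rewrite /= ler_wpM2l ?(ltW K0) //.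
by apply: le_trans (weight_le N); case/andP: (mass_bounds a01 sum_a wr).
Qed.

End LimitSetLower.

(** * The root of the polynomial and the weights it defines *)

Section SchottkyPoly.
Context {R : realType} (g k l : nat).
Hypotheses (hg : (2 <= g)%N) (hk : (1 <= k)%N) (hl : (1 <= l)%N).

Lemma horner_schottky_poly (x : R) : (schottky_poly g k l).[x] =
  x ^+ (k + l) + (1 - g%:R^-1) * x ^+ k - g%:R^-1.
Proof. by rewrite /schottky_poly !hornerE. Qed.

Let invg : 0 < (g%:R^-1 : R) <= 1 / 2.
Proof.
have g0 : 0 < g%:R :> R by rewrite ltr0n (leq_trans _ hg).
by rewrite invr_gt0 g0 div1r lef_pV2 ?posrE // ler_nat.
Qed.

(** The values at 0 and 1 are [- 1 / g] and [2 - 2 / g], and the polynomial increases strictly on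
    nonnegative numbers, so nothing beyond the root found in between is a root. *)
Lemma schottky_poly_root : exists u : R,
  [/\ 0 < u, u < 1 & largest_root (schottky_poly g k l) u].
Proof.
case/andP: invg => g0 g2.
have [||u /andP[u0 u1] ru] := @poly_ivt R (schottky_poly g k l) 0 1.
- exact: ler01.
- rewrite !horner_schottky_poly !expr0n !expr1n addn_eq0 !gtn_eqF //= ?andbF.
  by apply/andP; split; lra.
have pE := horner_schottky_poly u; rewrite (rootP ru) in pE.
have u_gt0 : 0 < u.
  rewrite lt_neqAle u0 andbT; apply/eqP => u0'; move: pE.
  by rewrite -u0' !expr0n addn_eq0 !gtn_eqF //=; lra.
have u_lt1 : u < 1.
  rewrite lt_neqAle u1 andbT; apply/eqP => u1'; move: pE.
  by rewrite u1' !expr1n; lra.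
exists u; split => //; split => // v rv; rewrite leNgt; apply/negP => uv.
have qE := horner_schottky_poly v; rewrite (rootP rv) in qE.
have h1 : u ^+ (k + l) < v ^+ (k + l) by rewrite ltrXn2r ?addn_eq0 ?gtn_eqF // ltW.
have h2 : u ^+ k < v ^+ k by rewrite ltrXn2r ?gtn_eqF // ltW.
by nra.
Qed.

Definition exponent (i : 'I_g.+1) : nat := if i == ord_max then l else k.

Lemma exponent_gt0 i : (1 <= exponent i)%N.
Proof. by rewrite /exponent; case: ifP. Qed.

(* The equation of [u] says that these weights form a Perron eigenvector, for the
   eigenvalue 1, of the matrix with entries [u ^+ exponent i * (i != j)]. *)
Lemma sum_root_weights (u : R) : 0 < u -> root (schottky_poly g k l) u ->
  \sum_(i < g.+1) u ^+ exponent i / (1 + u ^+ exponent i) = 1.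
Proof.
move=> u0 ru; rewrite big_ord_recr /= /exponent eqxx.
have widen_neq (i : 'I_g) H : (widen_ord H i == ord_max :> 'I_g.+1) = false.
  by rewrite -val_eqE /= ltn_eqF.
under eq_bigr => i _ do rewrite widen_neq.
rewrite sumr_const card_ord -mulr_natl.
have := horner_schottky_poly u; rewrite (rootP ru) exprD.
have := exprn_gt0 k u0; have := exprn_gt0 l u0.
have : g%:R != 0 :> R by rewrite pnatr_eq0 -lt0n (leq_trans _ hg).
move: (u ^+ k) (u ^+ l) (g%:R) => x y G G0 y0 x0 /esym pE.
have x1 : 1 + x != 0 by rewrite gt_eqF // addr_gt0.
have y1 : 1 + y != 0 by rewrite gt_eqF // addr_gt0.
have {}pE : G * (x * y) + (G - 1) * x - 1 = 0.
  rewrite -[RHS](mulr0 G) -pE; field; exact: G0.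
apply/eqP; rewrite -subr_eq0; apply/eqP.
(* Over the common denominator, the sum minus 1 has [g] times the polynomial as numerator. *)
rewrite -[RHS](mul0r ((1 + x) * (1 + y))^-1) -pE; field.
by rewrite x1 y1.
Qed.

End SchottkyPoly.

(** * Two-sided bounds for the dimension when [z] is small *)

Lemma powR_ge_expR {R : realType} (x s y : R) : 0 < x -> y <= s * ln x -> expR y <= x `^ s.
Proof. by move=> x0 yx; rewrite /powR gt_eqF // ler_expR. Qed.

Lemma powR_le_expR {R : realType} (x s y : R) : 0 < x -> s * ln x <= y -> x `^ s <= expR y.
Proof. by move=> x0 yx; rewrite /powR gt_eqF // ler_expR. Qed.

Section Asymptotics.
Context {R : realType} (g k l : nat).
Hypotheses (hk : (1 <= k)%N) (hl : (1 <= l)%N).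
Context (c : 'I_g.+1 -> R[i]) (d u : R).
Hypotheses (d01 : 0 < d <= 1) (c1 : forall i, modulus (c i) = 1)
  (c_sep : forall i j, i != j -> d <= modulus (c i - c j)).
Hypotheses (u0 : 0 < u) (u1 : u < 1)
  (sum_u : \sum_(i < g.+1) u ^+ exponent k l i / (1 + u ^+ exponent k l i) = 1).

Local Notation e i := (exponent k l i).

(** At exponent [s] the power of [r i ^+ 2] is exactly [u ^+ exponent k l i]. Changing [s] by the
    factor [1 - eta] or [1 + eta] gains a power of [u] that outweighs the distortion [9 / d ^+ 2],
    as [ln (modulus z^-1)] is large. *)
Lemma hausdorff_dim_schottky_bounds (eta : R) (z : R[i]) : 0 < eta < 1 ->
  z != 0 -> modulus z <= d / 4 -> 2 * ln (9 / d ^+ 2) / eta <= ln (modulus z^-1) ->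
  let s := (- ln u) / (2 * ln (modulus z^-1)) in
  0 < s /\ (((1 - eta) * s)%:E <=
    hausdorff_dim spherical_dist (limit_set (schottky_reflection_group k l c z))
    <= ((1 + eta) * s)%:E)%E.
Proof.
move=> /andP[eta0 eta1] z0 zd; case/andP: (d01) => d0 d1.
have z_gt0 : 0 < modulus z by rewrite modulus_gt0.
pose r (i : 'I_g.+1) := @schottky_radius R g k l z i.
have rE i : r i = modulus z ^+ e i by [].
have r_bnd i : 0 < r i <= d / 4.
  rewrite rE exprn_gt0 //=; apply: (le_trans _ zd).
  by rewrite -[leRHS]expr1 ler_wiXn2l ?(ltW z_gt0) //; [lra|exact: exponent_gt0].
have r_gt0 i : 0 < r i by case/andP: (r_bnd i).
have d2 : 0 < d ^+ 2 by rewrite exprn_gt0.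
have A1 : 1 < 9 / d ^+ 2 by rewrite ltr_pdivlMr //; nra.
have A0 := lt_trans ltr01 A1.
rewrite modulusV lnV ?posrE //.
have lnA : 0 < ln (9 / d ^+ 2) by rewrite ln_gt0.
set L := - ln (modulus z); set A := ln (9 / d ^+ 2) in lnA *.
have u_ln : 0 < - ln u by rewrite oppr_gt0 ln_lt0 // u0.
set m := - ln u in u_ln *.
rewrite ler_pdivrMr // => AL /=.
have L0 : 0 < L by nra.
have s0 : 0 < m / (2 * L) by rewrite divr_gt0 ?mulr_gt0.
have ln_r (i : 'I_g.+1) : ln (r i ^+ 2) = - (2 * (e i)%:R * L).
  rewrite rE !lnXn ?exprn_gt0 // -[_ *+ e i]mulr_natr -[_ *+ 2]mulr_natr /L.
  by ring.
have uE (i : 'I_g.+1) : u ^+ e i = expR (- ((e i)%:R * m)).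
  by rewrite -mulrN /m opprK expRM_natl lnK ?posrE.
have e1 (i : 'I_g.+1) : 1 <= (e i)%:R :> R by rewrite (ler_nat R 1) exponent_gt0.
have a_bnd (i : 'I_g.+1) : 0 < u ^+ e i <= u.
  by rewrite exprn_gt0 //= -[leRHS]expr1 ler_wiXn2l ?ltW //; exact: exponent_gt0.
split=> //; rewrite /schottky_reflection_group; apply/andP; split.
  apply: (hausdorff_dim_limit_set_ge d01 c1 c_sep r_bnd a_bnd u1 sum_u) => i.
  rewrite uE; apply: powR_ge_expR; first exact: colipc_gt0.
  rewrite /colipc ln_div ?posrE ?exprn_gt0 //.
  rewrite ln_r -/A.
  have -> : (1 - eta) * (m / (2 * L)) * (- (2 * (e i)%:R * L) - A) =
    - ((e i)%:R * m) + m * (eta * (e i)%:R - (1 - eta) * (A / (2 * L))).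
    by field; rewrite gt_eqF.
  rewrite lerDl mulr_ge0 ?(ltW u_ln) // subr_ge0.
  have : A / (2 * L) <= eta / 4 by rewrite ler_pdivrMr ?mulr_gt0 //; lra.
  have : 0 < A / (2 * L) by rewrite divr_gt0 ?mulr_gt0.
  by have := e1 i; nra.
have a01 (i : 'I_g.+1) : 0 < u ^+ e i <= 1.
  by case/andP: (a_bnd i) => -> /= /le_trans; apply; exact: ltW.
(* Here [theta] is [u] to the power [eta / 2]: the distortion uses up at most half of the gain
   [eta], because [A / (2 * L) <= eta / 4] and [1 + eta < 2]. *)
apply: (hausdorff_dim_limit_set_le d01 c1 c_sep r_bnd a01 sum_u
  (theta := expR (- (eta / 2 * m)))) => [||i].
- by rewrite mulr_gt0 // addr_gt0.
- by rewrite expR_gt0 -expR0 ltr_expR oppr_lt0 mulr_gt0 ?divr_gt0.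
rewrite uE -expRD; apply: powR_le_expR; first exact: lipc_gt0.
rewrite /lipc lnM ?posrE ?exprn_gt0 //.
rewrite ln_r -/A.
have -> : (1 + eta) * (m / (2 * L)) * (- (2 * (e i)%:R * L) + A) =
  - ((e i)%:R * m) - m * (eta * (e i)%:R - (1 + eta) * (A / (2 * L))).
  by field; rewrite gt_eqF.
rewrite [leRHS]addrC lerD2l lerN2 mulrC ler_pM2l //.
have : A / (2 * L) <= eta / 4 by rewrite ler_pdivrMr ?mulr_gt0 //; lra.
have : 0 < A / (2 * L) by rewrite divr_gt0 ?mulr_gt0.
by have := e1 i; nra.
Qed.

End Asymptotics.

(** * Separation of the centers and the limit as [z] tends to 0 *)

Lemma min_separation {R : realType} {I : finType} (c : I -> R[i]) : injective c ->
  exists2 d : R, 0 < d <= 1 & forall i j, i != j -> d <= modulus (c i - c j).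
Proof.
move=> c_inj.
(* Starting the minimum from 1 also ensures [d <= 1]. *)
exists (\big[Num.min/1]_(p : I * I | p.1 != p.2) modulus (c p.1 - c p.2)).
  rewrite bigmin_le_id andbT lt_bigmin // => -[i j] /= ij.
  by rewrite modulus_gt0 subr_eq0 (inj_eq c_inj).
by move=> i j ij; exact: (bigmin_le_cond _ _ (j := (i, j))).
Qed.

Theorem theorem4 (R : realType) (g k l : nat)
    (hg : (2 <= g)%N) (hk : (1 <= k)%N) (hl : (1 <= l)%N)
    (c : 'I_g.+1 -> R[i]) (hc_inj : injective c)
    (hc_unit : forall i, modulus (c i) = 1) :
  exists u : R,
    largest_root (schottky_poly g k l) u /\
    (hausdorff_dim spherical_dist (limit_set (schottky_reflection_group k l c z))
       / ((- ln u) / (2 * ln (modulus z^-1)))%:E)%E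
      @[z --> (0 : R[i]^o)^'] --> (1 : \bar R)%E.
Proof.
have [u [u0 u1 ur]] := @schottky_poly_root R g k l hg hk hl.
exists u; split=> //; have sum_u := sum_root_weights hg u0 (proj1 ur).
have [d d01 c_sep] := min_separation hc_inj; case/andP: (d01) => d0 d1.
pose D z := hausdorff_dim spherical_dist (limit_set (schottky_reflection_group k l c z)).
pose F z := (D z / ((- ln u) / (2 * ln (modulus z^-1)))%:E)%E.
suff : F @ (0 : R[i]^o)^' --> (1 : \bar R)%E by [].
have bounds (eta : R) : 0 < eta < 1 -> \forall z \near (0 : R[i]^o)^',
    exists2 q : R, F z = q%:E & `|1 - q| <= eta.
  move=> eta01; pose B := 2 * ln (9 / d ^+ 2) / eta.
  (* The first bound separates the disks, the second amounts to [B <= ln (modulus z^-1)]. *)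
  apply/nbhs_modulusP; exists (Num.min (d / 4) (expR (- B))).
    by rewrite lt_min expR_gt0 divr_gt0.
  move=> z; rewrite sub0r modulusN lt_min => /andP[zd zB] z0.
  have zm : 0 < modulus z by rewrite modulus_gt0.
  have [|s0 /andP[lo hi]] := hausdorff_dim_schottky_bounds hk hl d01 hc_unit c_sep
    u0 u1 sum_u eta01 z0 (ltW zd).
    rewrite modulusV lnV ?posrE // lerNr -/B.
    by rewrite -[leRHS]expRK ler_ln ?posrE ?expR_gt0 // ltW.
  rewrite -/(D z) in lo hi.
  (* Lying between two reals, the dimension is finite, so the quotient is a real number. *)
  have Dfin : D z \is a fin_num.
    by rewrite fin_numE gt_eqF ?lt_eqF // ?(le_lt_trans hi) ?ltry ?(lt_le_trans _ lo) ?ltNyr.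
  move: lo hi s0; rewrite /F -(fineK Dfin) !lee_fin.
  move: (- ln u / _) => s lo hi s0.
  exists (fine (D z) / s); first by rewrite inver gt_eqF // EFinM.
  rewrite -ler_pdivlMr // in lo; rewrite -ler_pdivrMr // in hi.
  by rewrite ler_norml; apply/andP; split; lra.
apply/fine_cvgP; split.
  have /bounds : 0 < (1 / 2 : R) < 1 by apply/andP; split; lra.
  by apply: filterS => z [q /= -> _].
apply/cvgrPdist_le => e e0.
have /bounds : 0 < Num.min e (1 / 2) < 1.
  by rewrite lt_min e0 gt_min; apply/andP; split; [lra|apply/orP; right; lra].
by apply: filterS => z [q /= -> ]; rewrite le_min => /andP[].
Qed.
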